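(* Let $\mu,\rho\in\mathbb{R}$, let $S:\mathbb{R}^n\rightrightarrows\mathbb{R}^n$ be a set-valued operator and $X\subseteq\mathbb{R}^n$ a closed linear subspace, and suppose that $\mathrm{link}_XS$ is nonempty. Let $(x^\star,y^\star)\in\mathrm{link}_XS$ and let $\mathcal{U}\subseteq\mathbb{R}^n\times\mathbb{R}^n$ be a set containing $(x^\star,y^\star)$. Then the following are equivalent. (i) $S$ is $(\mu\Pi_{X^\perp},\rho\Pi_X)$-semimonotone at $(x^\star,y^\star)$ on $\mathcal{U}$. (ii) The partial inverse $S^X$ has a $(\mu\Pi_{X^\perp}+\rho\Pi_X)$-oblique weak Minty solution at $\mathcal{S}^\star:=\{x^\star+y^\star\}\subseteq\mathrm{zer}\,S^X$ on $L_X(\mathcal{U})$.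
   Context: $\Pi_X,\Pi_{X^\perp}$ are the orthogonal projections onto $X$ and $X^\perp$. $\mathrm{gph}\,A=\{(x,y):y\in A(x)\}$, $\mathrm{zer}\,A=\{x:0\in A(x)\}$. $\mathrm{link}_XS$ is the set of all pairs $(x,y)$ with $x\in X$, $y\in X^\perp$, $y\in S(x)$. The map $L_X$ is $L_X(x,y)=\bigl(\Pi_X(x)+\Pi_{X^\perp}(y),\ \Pi_X(y)+\Pi_{X^\perp}(x)\bigr)$, and the partial inverse $S^X$ is the operator with $\mathrm{gph}\,S^X=L_X(\mathrm{gph}\,S)$. For symmetric matrices $M,R$, an operator $T$ is $(M,R)$-semimonotone at $(x',y')\in\mathrm{gph}\,T$ on a set $\mathcal{U}\ni(x',y')$ if $\langle x-x',y-y'\rangle\ge\langle x-x',M(x-x')\rangle+\langle y-y',R(y-y')\rangle$ for all $(x,y)\in\mathrm{gph}\,T\cap\mathcal{U}$. For a symmetric matrix $V$, $T$ has $V$-oblique weak Minty solutions at a nonempty convex set $\mathcal{S}^\star\subseteq\mathrm{zer}\,T$ on a set $\mathcal{U}'$ if $\langle v,\bar z-z^\star\rangle\ge\langle v,Vv\rangle$ for all $z^\star\in\mathcal{S}^\star$ and all $(\bar z,v)\in\mathrm{gph}\,T\cap\mathcal{U}'$. *)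

(* Defs.v *)
From HB Require Import structures.
From mathcomp Require Import all_boot all_order all_algebra.
From mathcomp Require Import boolp classical_sets reals topology normedtype convex.

Set Implicit Arguments.
Unset Strict Implicit.
Unset Printing Implicit Defensive.

Import Order.TTheory GRing.Theory Num.Theory.
Import numFieldNormedType.Exports.

Local Open Scope classical_set_scope.
Local Open Scope ring_scope.

Section OrthogonalProjection.
Variables (R : realType) (n : nat).
Implicit Types (u v : 'cV[R]_n) (X : {vspace 'cV[R]_n}).

Definition dotv u v : R := (u^T *m v) 0 0.

Lemma dotvE u v : dotv u v = \sum_i u i 0 * v i 0.
Proof. by rewrite /dotv mxE; apply: eq_bigr => i _; rewrite mxE. Qed.

Fact dotv_linearl v : GRing.linear_for *%R (dotv^~ v).
Proof. by move=> a x y; rewrite /dotv linearP /= mulmxDl -scalemxAl !mxE. Qed.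

Fact dotv_linearr u : GRing.linear_for *%R (dotv u).
Proof. by move=> a x y; rewrite /dotv mulmxDr -scalemxAr !mxE. Qed.

(* The second scaling must be [idfun \; *%R] rather than [*%R] for the
   hermitian structure (twisted by idfun), hence [orthov], to be found. *)
HB.instance Definition _ :=
  @bilinear_isBilinear.Build R 'cV[R]_n 'cV[R]_n R
    (GRing.Scale.Law.clone _ _ *%R _)
    (GRing.Scale.Law.clone _ _ (idfun \; *%R) _)
    dotv (dotv_linearl, dotv_linearr).

Fact dotv_hermitian u v : dotv u v = (-1) ^+ false * idfun (dotv v u).
Proof. by rewrite mul1r !dotvE; apply: eq_bigr => i _; rewrite mulrC. Qed.

HB.instance Definition _ :=
  @isHermitianSesquilinear.Build R 'cV[R]_n false idfun dotv dotv_hermitian.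

Lemma dotv_eq0 u : dotv u u = 0 -> u = 0.
Proof.
have ge0 i : 0 <= u i 0 * u i 0 by rewrite -expr2 sqr_ge0.
rewrite dotvE => /psumr_eq0P u0; apply/matrixP=> i j; rewrite (ord1 j) mxE.
by apply/eqP; rewrite -[_ == 0]orbb -mulf_eq0 u0.
Qed.

Definition orthc X : {vspace 'cV[R]_n} := orthov dotv X.

Lemma mem_orthcP X u : reflect {in X, forall v, dotv u v = 0} (u \in orthc X).
Proof. exact: mem_orthovP. Qed.

Lemma cap_orthc X : (X :&: orthc X = 0)%VS.
Proof.
apply/eqP; rewrite -subv0; apply/subvP=> u; rewrite memv_cap memv0.
by case/andP=> uX /mem_orthcP/(_ _ uX)/dotv_eq0/eqP.
Qed.

Lemma add_orthc X : (X + orthc X = fullv)%VS.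
Proof.
pose f u : 'rV[R]_(\dim X) := \row_i dotv u (vbasis X)`_i.
have f_lin : linear f.
  by move=> a u v; apply/rowP=> i; rewrite !mxE dotv_linearl.
pose fL : {linear 'cV[R]_n -> 'rV[R]_(\dim X)} :=
  HB.pack f (GRing.isLinear.Build _ _ _ _ f f_lin).
have kerf : (lker (linfun fL) <= orthc X)%VS.
  apply/subvP=> u; rewrite memv_ker lfunE /= => /eqP/rowP fu0.
  apply/mem_orthcP => v /coord_vbasis ->; rewrite linear_sumr big1 //= => i _.
  by have := fu0 i; rewrite !mxE linearZr /= => ->; rewrite mulr0.
have := limg_ker_dim (linfun fL) fullv; rewrite capfv => dimf.
apply/eqP; rewrite eqEdim subvf /= dimv_disjoint_sum ?cap_orthc // -dimf addnC.
rewrite leq_add ?dimvS // (leq_trans (dimvS (subvf _))) //.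
by rewrite dimvf /dim /= mul1n.
Qed.

(* Column j is the image of the j-th standard basis vector, so the matrix acts
   on column vectors by left multiplication. *)
Definition orthproj X : 'M[R]_n :=
  \matrix_(i, j) daddv_pi X (orthc X) (delta_mx j 0) i 0.

Lemma orthprojE X u : orthproj X *m u = daddv_pi X (orthc X) u.
Proof.
rewrite {2}[u]matrix_sum_delta linear_sum /=; apply/matrixP=> i j.
rewrite (ord1 j) mxE summxE; apply: eq_bigr => k _.
by rewrite big_ord1 linearZ !mxE mulrC.
Qed.

Lemma orthproj_mem X u : orthproj X *m u \in X.
Proof. by rewrite orthprojE memv_pi. Qed.

Lemma sub_orthproj_mem X u : u - orthproj X *m u \in orthc X.
Proof.
have uE : u \in (X + orthc X)%VS by rewrite add_orthc memvf.
rewrite orthprojE -{1}(daddv_pi_add (cap_orthc X) uE).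
by rewrite addrAC subrr add0r memv_pi.
Qed.

End OrthogonalProjection.

Section Operators.
Variables (R : realType) (n : nat).
Implicit Types (S T : 'cV[R]_n -> set 'cV[R]_n) (X : {vspace 'cV[R]_n}).
Implicit Types (U : set ('cV[R]_n * 'cV[R]_n)) (p : 'cV[R]_n * 'cV[R]_n).

Definition gph T : set ('cV[R]_n * 'cV[R]_n) := [set p | T p.1 p.2].

Definition zer T : set 'cV[R]_n := [set x | T x 0].

Definition link X S : set ('cV[R]_n * 'cV[R]_n) :=
  [set p | [/\ p.1 \in X, p.2 \in orthc X & S p.1 p.2]].

Definition Lmap X p : 'cV[R]_n * 'cV[R]_n :=
  (orthproj X *m p.1 + orthproj (orthc X) *m p.2,
   orthproj X *m p.2 + orthproj (orthc X) *m p.1).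

Definition partial_inverse X S : 'cV[R]_n -> set 'cV[R]_n :=
  fun z => [set v | (Lmap X @` gph S) (z, v)].

Lemma gph_partial_inverse X S : gph (partial_inverse X S) = Lmap X @` gph S.
Proof. by apply/seteqP; split=> -[]. Qed.

(* Points of the graph are pairs: p is (x', y') and q is (x, y). *)
Definition semimonotone_at (M N : 'M[R]_n) T p U : Prop :=
  [/\ M \is symmetricmx, N \is symmetricmx, gph T p, U p &
    forall q, (gph T `&` U) q ->
      dotv (q.1 - p.1) (M *m (q.1 - p.1)) + dotv (q.2 - p.2) (N *m (q.2 - p.2))
        <= dotv (q.1 - p.1) (q.2 - p.2)].

(* Z is the set of solutions, and q is the graph point (zbar, v). *)
Definition oblique_weak_minty (V : 'M[R]_n) T (Z : set 'cV[R]_n) U : Prop :=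
  [/\ V \is symmetricmx, Z !=set0, convex_set Z, Z `<=` zer T &
    forall z, Z z -> forall q, (gph T `&` U) q ->
      dotv q.2 (V *m q.2) <= dotv q.2 (q.1 - z)].

End Operators.

(* Main.v *)
(* Writing x = a + b and y = c + d along X and its orthogonal complement, L_X
   sends (x, y) to (a + d, c + b): it swaps the two components in the complement.
   Hence it is an involution, so graph points of S in U correspond exactly to
   graph points of the partial inverse in L_X(U), and it turns each side of the
   semimonotonicity inequality at (xs, ys) into the corresponding side of the
   weak Minty inequality at xs + ys, because xs lies in X and ys in the
   complement. *)
Require Import Defs.
From mathcomp Require Import all_boot all_order all_algebra.
From mathcomp Require Import boolp classical_sets reals topology normedtype convex.
Import Order.TTheory GRing.Theory Num.Theory.
Import numFieldNormedType.Exports.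
Local Open Scope classical_set_scope.
Local Open Scope ring_scope.

Section PartialInverse.
Context {R : realType} {n : nat}.
Implicit Types (u v : 'cV[R]_n) (X : {vspace 'cV[R]_n}).

Lemma dotvC u v : dotv u v = dotv v u.
Proof. by rewrite !dotvE; apply: eq_bigr => i _; rewrite mulrC. Qed.

Lemma dotv_orthc X u v : u \in X -> v \in orthc X -> dotv u v = 0.
Proof.
by move=> uX /mem_orthcP/(_ _ uX); rewrite dotvC.
Qed.

Lemma dotvD_orthc X u1 v1 u2 v2 :
    u1 \in X -> v1 \in orthc X -> u2 \in X -> v2 \in orthc X ->
  dotv (u1 + v1) (u2 + v2) = dotv u1 u2 + dotv v1 v2.
Proof.
move=> u1X v1X u2X v2X; rewrite linearDl !linearDr /= (dotv_orthc _ u1 v2 u1X v2X).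
by move/mem_orthcP: v1X => ->//; rewrite addr0 add0r.
Qed.

(** Lets [orthprojD] be applied to [orthc X], with [X] serving as its complement. *)
Lemma sub_orthc_orthc X : (X <= orthc (orthc X))%VS.
Proof. by apply/subvP=> u uX; apply/mem_orthcP=> v; apply: dotv_orthc. Qed.

(** The difference of the two sides lies both in [X] and in [orthc X], hence vanishes. *)
Lemma orthprojD X u v : u \in X -> v \in orthc X -> orthproj X *m (u + v) = u.
Proof.
move=> uX vX; apply/eqP; rewrite eq_sym -subr_eq0 -memv0 -(cap_orthc X).
rewrite memv_cap rpredB ?orthproj_mem //=.
have -> : u - orthproj X *m (u + v) = (u + v - orthproj X *m (u + v)) - v.
  by rewrite addrAC addrK.
by rewrite rpredB ?sub_orthproj_mem.
Qed.

Lemma orthproj_orthcD X u v :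
  u \in X -> v \in orthc X -> orthproj (orthc X) *m (u + v) = v.
Proof.
move=> uX vX; rewrite addrC orthprojD //.
exact: (subvP (sub_orthc_orthc X)) uX.
Qed.

(** The residual [u - orthproj X *m u] lies in the complement, so it is the projection of [u]
    there. *)
Lemma orthprojK X u : orthproj X *m u + orthproj (orthc X) *m u = u.
Proof.
have := orthproj_orthcD _ _ _ (orthproj_mem X u) (sub_orthproj_mem X u).
by rewrite addrC subrK => ->; rewrite addrC subrK.
Qed.

Lemma dotv_orthproj X u v : dotv u (orthproj X *m v) = dotv (orthproj X *m u) v.
Proof.
(* Both sides reduce to the product of the projections of [u] and [v] onto [X]; the zeros are
   components that make [dotvD_orthc] applicable. *)
have: dotv (orthproj X *m u + orthproj (orthc X) *m u) (orthproj X *m v + 0) =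
      dotv (orthproj X *m u + 0) (orthproj X *m v + orthproj (orthc X) *m v).
  by rewrite !(dotvD_orthc X) ?orthproj_mem ?mem0v // linear0r linear0l.
by rewrite !orthprojK !addr0.
Qed.

(** Self-adjointness, tested on two standard basis vectors, compares the entries at (i, j) and (j,
    i). *)
Lemma trmx_orthproj X : (orthproj X)^T = orthproj X.
Proof.
apply/matrixP=> i j; have := dotv_orthproj X (delta_mx i 0) (delta_mx j 0).
rewrite /dotv trmx_mul -!mulmxA !trmx_delta -!colE -!rowE !mxE.
by move=> ->.
Qed.

Lemma orthproj_symmetricmx X a : a *: orthproj X \is symmetricmx.
Proof.
by apply/is_hermitianmxP; rewrite scale1r map_mx_id // linearZ /= trmx_orthproj.
Qed.

Lemma symmetricmxD (A B : 'M[R]_n) :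
  A \is symmetricmx -> B \is symmetricmx -> A + B \is symmetricmx.
Proof.
move=> /is_hermitianmxP symA /is_hermitianmxP symB; apply/is_hermitianmxP.
by rewrite {1}symA {1}symB !linearD /= map_mxD scalerDr.
Qed.

Lemma LmapD X u1 v1 u2 v2 :
    u1 \in X -> v1 \in orthc X -> u2 \in X -> v2 \in orthc X ->
  Lmap X (u1 + v1, u2 + v2) = (u1 + v2, u2 + v1).
Proof.
by move=> *; rewrite /Lmap /= !(orthproj_orthcD X) // !(orthprojD X).
Qed.

Lemma LmapK X : involutive (Lmap X).
Proof.
move=> [x y]; rewrite {2}/Lmap /= LmapD ?orthproj_mem //.
by rewrite !orthprojK.
Qed.

End PartialInverse.

Theorem corollary4p6 (R : realType) (n : nat) (mu rho : R)
    (S : 'cV[R]_n -> set 'cV[R]_n)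
    (X : {vspace 'cV[R]_n}) (X_closed : closed [set` X])
    (link_neq0 : link X S !=set0)
    (xs ys : 'cV[R]_n) (link_xys : link X S (xs, ys))
    (U : set ('cV[R]_n * 'cV[R]_n)) (U_xys : U (xs, ys)) :
  semimonotone_at (mu *: orthproj (orthc X)) (rho *: orthproj X) S (xs, ys) U
  <->
  oblique_weak_minty (mu *: orthproj (orthc X) + rho *: orthproj X)
    (partial_inverse X S) [set xs + ys] (Lmap X @` U).
Proof.
have [/= xsX ysX Sxs] := link_xys.
have decomp (u : 'cV[R]_n) : exists a b, [/\ a \in X, b \in orthc X & u = a + b].
  exists (orthproj X *m u), (orthproj (orthc X) *m u).
  by rewrite !orthproj_mem orthprojK.
have normE x y : dotv (x - xs) (mu *: orthproj (orthc X) *m (x - xs))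
      + dotv (y - ys) (rho *: orthproj X *m (y - ys))
    = dotv (Lmap X (x, y)).2
        ((mu *: orthproj (orthc X) + rho *: orthproj X) *m (Lmap X (x, y)).2).
  (* Subtracting [xs] leaves the complement part [b] of [x] unchanged, and subtracting [ys] leaves
     the part [c] of [y] in [X] unchanged. Both sides are thus [mu] times the square of [b] plus
     [rho] times the square of [c]. *)
  have [a [b [aX bX ->]]] := decomp x; have [c [d [cX dX ->]]] := decomp y.
  rewrite LmapD //= mulmxDl -!scalemxAl addrAC -[c + d - ys]addrA.
  rewrite !(orthproj_orthcD X) ?rpredB // !(orthprojD X) ?rpredB //.
  rewrite [mu *: b + _]addrC (dotvD_orthc X) ?rpredZ // -[mu *: b]add0r -[rho *: c]addr0.
  rewrite !(dotvD_orthc X) ?rpredB ?mem0v ?rpredZ //.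
  by rewrite !linear0r !add0r !addr0 addrC.
have dotE x y : dotv (x - xs) (y - ys)
    = dotv (Lmap X (x, y)).2 ((Lmap X (x, y)).1 - (xs + ys)).
  (* Both sides equal [dotv (a - xs) c + dotv b (d - ys)], up to symmetry of [dotv]. *)
  have [a [b [aX bX ->]]] := decomp x; have [c [d [cX dX ->]]] := decomp y.
  rewrite LmapD //= addrAC -[c + d - ys]addrA opprD addrACA.
  by rewrite !(dotvD_orthc X) ?rpredB // dotvC [dotv b _]dotvC.
have LmapI q : (gph (partial_inverse X S) `&` Lmap X @` U) (Lmap X q) <->
    (gph S `&` U) q.
  rewrite gph_partial_inverse; split=> [[[p Sp eqS] [p' Up' eqU]]|[Sq Uq]].
    (* The preimages [p] in [gph S] and [p'] in [U] both coincide with [q], an involution being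
       injective. *)
    by split; [rewrite -(can_inj (LmapK X) eqS) | rewrite -(can_inj (LmapK X) eqU)].
  by split; exists q.
split=> [[_ _ _ _ SM]|[_ _ _ _ WM]].
  split; rewrite ?symmetricmxD ?orthproj_symmetricmx //.
  - by exists (xs + ys).
  - by move=> x y l; rewrite !inE => -> ->; rewrite convmm.
  - move=> _ ->; exists (xs, ys) => //.
    (* [Lmap X] sends [(xs, ys)] to [(xs + ys, 0)], so [xs + ys] is a zero. *)
    by rewrite -[xs]addr0 -[ys]add0r LmapD ?mem0v // !addr0 add0r.
  (* An arbitrary [q] is the image of [Lmap X q], the form that [LmapI] requires. *)
  - move=> _ -> q; rewrite -[q](LmapK X) => /LmapI; case: (Lmap X q) => x y /SM /=.
    by rewrite normE dotE.
split; rewrite ?orthproj_symmetricmx // => -[x y] /LmapI /(WM _ erefl).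
by rewrite normE dotE.
Qed.
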